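(* Let $n\in\mathbb{N}$, let $G$ be a collection of maps from $I=\{1,\dots,n\}$ to a probability space $(\Omega,\mathcal F,\mu)$, let $C_G\ge 1$ be a constant depending only on $G$, and let $\mathbb{P}$ be a probability measure on $G$. Assume that for all $i\in I$, all different indices $i_1,i_2\in I$ and all measurable sets $A,A_1,A_2\subset\Omega$: (i) $\mathbb{P}(g(i)\in A)=\mu(A)$, (ii) $\mathbb{P}(g(i_1)\in A_1,\ g(i_2)\in A_2)\le C_G\,\mu(A_1)\mu(A_2)$. Then, for every measurable function $a:I\times\Omega\to\mathbb{R}$ and every integer $\ell$ with $1\le \ell\le n$, $$c\int_0^\ell a^*(t)\,dt\ \le\ \int_G\sum_{k=1}^{\ell}\operatorname*{k\text{-}max}_{1\le i\le n}|a(i,g(i))|\,d\mathbb{P}(g)\ \le\ C\int_0^\ell a^*(t)\,dt,$$ where $1/c=48(1+2C_G)^2$ and $C=6(1+2C_G)$.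
   Context: For real numbers $y_1,\dots,y_n$, $\operatorname{k-max}_{1\le i\le n}y_i$ denotes the $k$-th largest value among $y_1,\dots,y_n$ (counted with multiplicity). The set $I\times\Omega$ carries the product $\sigma$-algebra and the product measure $\sigma=\delta\otimes\mu$, with $\delta$ the counting measure on $I$. The decreasing rearrangement of $a$ is $a^*(t)=\inf\{s\ge 0:\sigma(|a|>s)\le t\}$ for $t\ge0$, with $\inf\emptyset=\infty$. The $\sigma$-algebra on $G$ is assumed to make all evaluation maps $g\mapsto g(i)$, $i\in I$, measurable (this is implicit in (i) and (ii)). *)

(* Defs.v *)
From HB Require Import structures.
From mathcomp Require Import all_boot all_order all_algebra.
From mathcomp Require Import all_classical all_reals all_analysis.

Set Implicit Arguments.
Unset Strict Implicit.
Unset Printing Implicit Defensive.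

Import Order.TTheory GRing.Theory Num.Theory.
Import numFieldNormedType.Exports.

Local Open Scope classical_set_scope.
Local Open Scope ring_scope.

(* The index set is 'I_n.+1 (indices shifted to start at 0): a measurableType
   must be inhabited. *)
HB.instance Definition _ n := isPointed.Build 'I_n.+1 ord0.
HB.instance Definition _ n := @isMeasurable.Build default_measure_display
  'I_n.+1 discrete_measurable discrete_measurable0
  discrete_measurableC discrete_measurableU.

(* The subtype of the elements of G. The proof of non-emptiness only serves
   to choose the distinguished point that a measurableType carries. *)
Definition subtype_of (T : choiceType) (G : set T) (G0 : G !=set0) : Type :=
  set_type G.

Section subtype_of.
Variables (T : choiceType) (G : set T) (G0 : G !=set0).

HB.instance Definition _ := Choice.copy (subtype_of G0) (set_type G).
HB.instance Definition _ := isPointed.Build (subtype_of G0)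
  (SigSub (mem_set (projT2 (cid G0)))).
End subtype_of.

(* k counts from 1; the value is only meaningful for 1 <= k <= n. *)
Definition kmax (R : realType) (n k : nat) (y : 'I_n -> R) : R :=
  nth 0 (sort >=%R [seq y i | i : 'I_n]) k.-1.

Definition decreasing_rearrangement (d : measure_display)
    (T : measurableType d) (R : realType) (m : set T -> \bar R) (f : T -> R)
    (t : R) : \bar R :=
  ereal_inf [set s%:E | s in
    [set s : R | 0 <= s /\ (m [set x | (s < `|f x|)%R] <= t%:E)%E]].

(* Main.v *)
(* Layer cake reduces both sides to integrals over the levels [s >= 0].  Let
   [N s g] be the number of [i] with [s < |a (i, g i)|] and
   [D s = (counting \x mu) (|a| > s)].  Then
     [sum_(k <= l) kmax k = int_s min l (N s g)] and
     [int_0^l a^* = int_s min l (D s)],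
   so by Tonelli it suffices to compare [E (min l (N s))] with [min l (D s)]
   for each [s].  Condition (i) gives [E (N s) = D s], hence the upper bound
   (with constant 1) by concavity; condition (ii) gives
   [E (N s ^+ 2) <= D s + CG * D s ^+ 2], and a second moment argument yields
   the lower bound with constant [1 / (2 * CG)]. *)
Require Import Defs.
From HB Require Import structures.
From mathcomp Require Import all_boot all_order all_algebra.
From mathcomp Require Import all_classical all_reals all_analysis.
(* Imported again: after [Defs] the measurable structure of [\bar R] is
   otherwise not inferred. *)
From mathcomp Require Import measurable_realfun.
From mathcomp Require Import zify ring lra.

Set Implicit Arguments.
Unset Strict Implicit.
Unset Printing Implicit Defensive.

Import Order.TTheory GRing.Theory Num.Theory.
Import numFieldNormedType.Exports.

Local Open Scope classical_set_scope.
Local Open Scope ring_scope.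

(** * Tonelli's theorem on rectangles *)

Lemma integral_in_mkcondX d1 d2 (T1 : measurableType d1)
    (T2 : measurableType d2) (R : realType)
    (m2 : {measure set T2 -> \bar R}) (D1 : set T1) (D2 : set T2)
    (f : T1 * T2 -> \bar R) (x : T1) :
  (\int[m2]_y (f \_ (D1 `*` D2)) (x, y) =
   ((fun x => \int[m2]_(y in D2) f (x, y)) \_ D1) x)%E.
Proof.
rewrite patchE; case: ifPn => [|/negP] D1x.
  rewrite [RHS]integral_mkcond; apply: eq_integral => y _.
  by rewrite !patchE in_setX D1x.
by apply: integral0_eq => y _; rewrite patchE in_setX (negbTE (introN idP D1x)).
Qed.

Section tonelli_in.
Local Open Scope ereal_scope.
Context d1 d2 (T1 : measurableType d1) (T2 : measurableType d2) (R : realType).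
Variables (m1 : {sigma_finite_measure set T1 -> \bar R}).
Variables (m2 : {sigma_finite_measure set T2 -> \bar R}).
Variables (D1 : set T1) (D2 : set T2) (f : T1 * T2 -> \bar R).
Hypotheses (mD1 : measurable D1) (mD2 : measurable D2).
Hypotheses (mf : measurable_fun setT f) (f0 : forall z, 0 <= f z).

Let mfX (A1 : set T1) (A2 : set T2) : measurable A1 -> measurable A2 ->
  measurable_fun setT (f \_ (A1 `*` A2) : T1 * T2 -> \bar R).
Proof.
move=> mA1 mA2; apply/(measurable_restrictT _ (measurableX mA1 mA2)).
exact: measurable_funTS.
Qed.

Let fX_ge0 (A : set (T1 * T2)) z : 0 <= (f \_ A) z.
Proof. by rewrite patchE; case: ifP. Qed.

(** Extending [f] by 0 outside [D1 x D2] turns both iterated integrals into integrals over the whole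
    spaces, where Tonelli applies. *)
Lemma tonelli_in :
  \int[m1]_(x in D1) \int[m2]_(y in D2) f (x, y) =
  \int[m2]_(y in D2) \int[m1]_(x in D1) f (x, y).
Proof.
have := fubini_tonelli (m1 := m1) (m2 := m2) _ (mfX mD1 mD2) (fX_ge0 _).
move=> tonelli; rewrite integral_mkcond [in RHS]integral_mkcond.
transitivity (\int[m1]_x \int[m2]_y (f \_ (D1 `*` D2)) (x, y)).
  by apply: eq_integral => x _; rewrite integral_in_mkcondX.
rewrite tonelli; apply: eq_integral => y _.
rewrite patchE; case: ifPn => [|/negP] D2y.
  rewrite [RHS]integral_mkcond; apply: eq_integral => x _.
  by rewrite !patchE in_setX D2y andbT.
apply: integral0_eq => x _.
by rewrite patchE in_setX (negbTE (introN idP D2y)) andbF.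
Qed.

Lemma measurable_integral_in :
  measurable_fun setT (fun x => \int[m2]_(y in D2) f (x, y)).
Proof.
have := measurable_fun_fubini_tonelli_F (m2 := m2) _
  (mfX (@measurableT _ T1) mD2) (fX_ge0 _).
apply: eq_measurable_fun => x _.
by rewrite /fubini_F integral_in_mkcondX patchE in_setT.
Qed.

End tonelli_in.

(** * Lengths of level sets on the half-line *)

Lemma integral_bool d (T : measurableType d) (R : realType)
    (m : {measure set T -> \bar R}) (D : set T) (b : T -> bool) :
  measurable D -> measurable (D `&` [set x | b x]) ->
  (\int[m]_(x in D) (b x)%:R%:E = m (D `&` [set x | b x]))%E.
Proof.
move=> mD mb; rewrite -[X in m X]setIT -(integral_indic m measurableT mb).
rewrite integral_mkcond; apply: eq_integral => x _.
by rewrite patchE indicE in_setI [x \in [set x | b x]]asboolb; case: ifP.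
Qed.

Lemma lebesgue_measure_itv0 (R : realType) (b : bool) (r : R) : 0 <= r ->
  lebesgue_measure [set` Interval (BLeft 0) (BSide b r)] = r%:E.
Proof.
move=> r0; rewrite lebesgue_measure_itv/= lte_fin lt_neqAle r0 andbT.
by case: eqP => [<-|_] //=; rewrite sube0.
Qed.

Lemma integral_lt_itv0y (R : realType) (r : R) : 0 <= r ->
  (\int[lebesgue_measure]_(s in `[0%R, +oo[) (s < r)%R%:R%:E = r%:E)%E.
Proof.
move=> r0.
have E : `[0, +oo[ `&` [set s | s < r] = `[0, r[%classic.
  apply/seteqP; split => s /=; rewrite !in_itv/= andbT; first by case=> -> ->.
  by move=> /andP[].
by rewrite integral_bool /= ?E// lebesgue_measure_itv0.
Qed.

Lemma integral_lt_itv0l (R : realType) (l r : R) : 0 <= l -> 0 <= r ->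
  (\int[lebesgue_measure]_(t in `[0%R, l]) (t < r)%R%:R%:E
     = (Num.min l r)%:E)%E.
Proof.
move=> l0 r0; have [lr|rl] := ltP l r.
  have E : `[0, l] `&` [set s | s < r] = `[0, l]%classic.
    apply/setIidPl => s /=; rewrite in_itv/= => /andP[_ sl].
    exact: le_lt_trans lr.
  by rewrite integral_bool /= ?E// lebesgue_measure_itv0.
have E : `[0, l] `&` [set s | s < r] = `[0, r[%classic.
  apply/seteqP; split => s /=; rewrite !in_itv/=; first by case=> /andP[->].
  by move=> /andP[-> sr]; split => //; rewrite (le_trans (ltW sr)).
by rewrite integral_bool /= ?E// lebesgue_measure_itv0.
Qed.

(** An up-closed [V] leaves in [[0, +oo[] an interval starting at 0 and ending at [inf W], or all of
    [[0, +oo[] when [W] is empty. With [V] the set of [s] such that [D s <= t], the infimum is the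
    value at [t] of the decreasing rearrangement. *)
Lemma lebesgue_measure_initial_segment (R : realType) (V : set R) :
  (forall x y, V x -> x <= y -> V y) ->
  (lebesgue_measure (`[0%R, +oo[ `&` ~` V)
     = ereal_inf [set x%:E | x in [set x : R | (0 <= x)%R /\ V x]])%E.
Proof.
move=> Vup; set W := [set x | _ /\ _].
have [W_eq0|/set0P W0] := eqVneq W set0.
  rewrite W_eq0.
  rewrite image_set0 ereal_inf0.
  have -> : `[0, +oo[ `&` ~` V = `[0, +oo[%classic.
    apply/setIidPl => x; rewrite /= in_itv/= andbT => x0 Vx.
    by have : W x by []; rewrite W_eq0.
  by rewrite lebesgue_measure_itv/= ltry.
have Wlb : has_lbound W by exists 0 => x [].
rewrite ereal_inf_EFin//.
have inf_ge0 : 0 <= inf W by apply: lb_le_inf => // x [].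
have sub1 : `[0, inf W[ `<=` `[0, +oo[ `&` ~` V.
  move=> x; rewrite /= !in_itv/= => /andP[x0 xW]; split; first by rewrite x0.
  by move=> Vx; move: xW; rewrite ltNge ge_inf.
have sub2 : `[0, +oo[ `&` ~` V `<=` `[0, inf W].
  move=> x [] /=; rewrite !in_itv/= andbT => x0 Vx; rewrite x0/=.
  apply: lb_le_inf => // y [_ Vy]; rewrite leNgt; apply/negP => yx.
  exact/Vx/(Vup y)/ltW.
(* The two inclusions leave only the point [inf W] undecided: the set is [[0, inf W[] or
   [[0, inf W]] according to whether [inf W] lies in [V]. *)
have mV : measurable (`[0, +oo[ `&` ~` V).
  have [Winf|Winf] := pselect (V (inf W)).
    have -> : `[0, +oo[ `&` ~` V = `[0, inf W[%classic.
      apply/seteqP; split => // x Vx; have := sub2 _ Vx.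
      rewrite /= !in_itv/= => /andP[->]; rewrite le_eqVlt => /predU1P[xE|//].
      by case: Vx => _ []; rewrite xE.
    exact: measurable_itv.
  have -> : `[0, +oo[ `&` ~` V = `[0, inf W]%classic.
    apply/seteqP; split => // x; rewrite /= !in_itv/= => /andP[x0].
    rewrite le_eqVlt => /predU1P[->|xW]; first by rewrite inf_ge0.
    by apply: sub1; rewrite /= in_itv/= x0.
  exact: measurable_itv.
have len b : lebesgue_measure [set` Interval (BLeft 0) (BSide b (inf W))]
    = (inf W)%:E by exact: lebesgue_measure_itv0.
by apply/eqP; rewrite eq_le -{1}(len false) -(len true) !le_measure// inE.
Qed.

(** * The k-th largest value and counts of large entries *)

(** In a nonincreasing list the entries above [x] form a prefix: once the head is at most [x], so is
    the whole tail and the count vanishes. *)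
Lemma count_gt_sorted_nth (R : realDomainType) (x0 x : R) (s : seq R)
    (k : nat) :
  sorted >=%R s -> (k < size s)%N ->
  (k < count (> x) s)%N = (x < nth x0 s k).
Proof.
elim: s k => //= y s IHs k ys ks.
have sy : all (<= y) s.
  by apply: order_path_min ys => a b c /[swap]; exact: le_trans.
case: ltP => xy; last first.
  have -> : count (> x) s = 0%N.
    apply/eqP; rewrite -leqn0 leqNgt -has_count; apply/hasPn => z /(allP sy) zy.
    by rewrite /= -leNgt (le_trans zy).
  rewrite addn0 ltn0; case: k ks => [|k] ks /=; first by rewrite ltNge xy.
  apply/esym/negbTE; rewrite -leNgt.
  by apply: le_trans xy; apply: (allP sy); rewrite mem_nth.
case: k ks => [|k] ks /=; first by rewrite xy.
by rewrite add1n ltnS IHs// (path_sorted ys).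
Qed.

(** This duality replaces sorting by counting. Since [kmax] counts from 1 and [nth] from 0, the
    strict bound on the index becomes [k <= _]. *)
Lemma lt_kmax (R : realType) (n k : nat) (y : 'I_n -> R) (s : R) :
  (0 < k <= n)%N ->
  (s < kmax k y) = (k <= \sum_(i < n) (s < y i)%R)%N.
Proof.
case: k => //= k kn; rewrite /kmax/=.
rewrite -count_gt_sorted_nth; last 2 first.
- by apply: sort_sorted => a b; exact: le_total.
- by rewrite size_sort size_map -cardE card_ord.
by rewrite count_sort count_map -sum1_count big_enum_cond -big_mkcond.
Qed.

Lemma kmax_ge0 (R : realType) (n k : nat) (y : 'I_n -> R) :
  (forall i, 0 <= y i) -> 0 <= kmax k y.
Proof.
move=> y0; rewrite /kmax; set s := sort _ _.
(* Past the end of the list, [nth] returns its default value 0. *)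
have [ks|ks] := ltnP k.-1 (size s); last by rewrite nth_default.
have /mapP[i _ ->] // : nth 0 s k.-1 \in [seq y i | i : 'I_n].
by rewrite -(mem_sort >=%R) mem_nth.
Qed.

Lemma minn_sum_leq (l N : nat) : (\sum_(1 <= k < l.+1) (k <= N) = minn l N)%N.
Proof.
elim: l => [|l IHl]; first by rewrite big_geq ?min0n.
rewrite big_nat_recr//= IHl; lia.
Qed.

Lemma natr_minn (R : realDomainType) (l N : nat) :
  ((minn l N)%:R = Num.min l%:R N%:R :> R).
Proof. by rewrite /Order.min ltr_nat /minn; case: ifP. Qed.

(** If [N] entries exceed [s], then [s < kmax k y] holds exactly for [k <= N], so [min l N] of the
    first [l] indices contribute. *)
Lemma sum_lt_kmax (R : realType) (n l : nat) (y : 'I_n -> R) (s : R) :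
  (l <= n)%N ->
  \sum_(1 <= k < l.+1) (s < kmax k y)%R%:R
    = Num.min l%:R (\sum_(i < n) (s < y i)%R%:R) :> R.
Proof.
move=> ln.
rewrite -[X in Num.min _ X]natr_sum -natr_minn -minn_sum_leq natr_sum.
 apply: eq_big_nat => k /andP[k0 kl].
by rewrite lt_kmax// k0 (leq_trans _ ln).
Qed.

(** * First and second moments of a count of events, truncated at [l] *)

Section truncated_count.
Context d (T : measurableType d) (R : realType) (P : probability T R).
Variables (n : nat) (E : 'I_n -> set T) (p : 'I_n -> R) (C : R) (l : nat).
Hypothesis mE : forall i, measurable (E i).
Hypothesis PE : forall i, P (E i) = (p i)%:E.
Hypothesis C_ge1 : 1 <= C.
Hypothesis PEI : forall i j, i != j ->
  (P (E i `&` E j) <= (C * p i * p j)%:E)%E.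
Hypothesis l_gt0 : (0 < l)%N.

Let N (x : T) : R := \sum_(i < n) \1_(E i) x.
Let D : R := \sum_(i < n) p i.

Let N_ge0 x : 0 <= N x. Proof. by apply: sumr_ge0 => i _. Qed.

Let p_ge0 i : 0 <= p i. Proof. by rewrite -lee_fin -PE. Qed.

Let D_ge0 : 0 <= D. Proof. exact: sumr_ge0. Qed.

Let mN : measurable_fun setT N.
Proof. by apply: measurable_sum => i; exact: measurable_indic. Qed.

Let min_ge0 (r : R) : 0 <= r -> 0 <= Num.min l%:R r.
Proof. by move=> r0; rewrite le_min ler0n. Qed.

Let mmin : measurable_fun setT (fun x => Num.min l%:R (N x)).
Proof. exact: (measurable_minr (measurable_cst _)). Qed.

Let integral_N : (\int[P]_x (N x)%:E = D%:E)%E.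
Proof.
under eq_integral do rewrite /N -sumEFin.
rewrite ge0_integral_sum//; last first.
  by move=> i; apply/measurable_EFinP; exact: measurable_indic.
rewrite /D -sumEFin; apply: eq_bigr => i _.
by rewrite integral_indic// setIT; exact: PE.
Qed.

(** Expanding the square, the diagonal pairs contribute [D], and the off-diagonal ones are
    controlled by the pair bound [PEI]. *)
Let integral_N2 : (\int[P]_x (N x ^+ 2)%:E <= (D + C * D ^+ 2)%:E)%E.
Proof.
have N2 x : N x ^+ 2 = \sum_(i < n) \sum_(j < n) \1_(E i `&` E j) x.
  rewrite expr2 /N mulr_suml; apply: eq_bigr => i _; rewrite mulr_sumr.
  by apply: eq_bigr => j _; rewrite indicI.
under eq_integral => x _.
  rewrite N2 -sumEFin; under eq_bigr do rewrite -sumEFin. over.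
rewrite ge0_integral_sum//; last first.
- by move=> i x _; apply: sume_ge0 => j _; rewrite lee_fin.
- move=> i; apply: emeasurable_sum => j; apply/measurable_EFinP.
  by apply: measurable_indic; exact: measurableI.
(* The bound is split by rows to match the double sum; its extra nonnegative terms [C * p i * p i]
   are slack. *)
have -> : D + C * D ^+ 2 = \sum_(i < n) (p i + \sum_(j < n) C * p i * p j).
  rewrite big_split/= expr2 {2}/D mulr_suml mulr_sumr; congr (_ + _).
  apply: eq_bigr => i _; rewrite /D !mulr_sumr.
  by apply: eq_bigr => j _; rewrite mulrA.
rewrite -sumEFin; apply: lee_sum => i _.
rewrite ge0_integral_sum//; last first.
  move=> j; apply/measurable_EFinP.
  by apply: measurable_indic; exact: measurableI.
rewrite (eq_bigr (fun j => P (E i `&` E j))); last first.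
  by move=> j _; rewrite integral_indic ?setIT//; exact: measurableI.
rewrite (bigD1 i)//= setIid PE [X in (_ + X)%:E](bigD1 i)//= addrA EFinD.
rewrite leeD//.
  by rewrite lee_fin lerDl !mulr_ge0// (le_trans ler01).
by rewrite -sumEFin lee_sum// => j ji; rewrite PEI// eq_sym.
Qed.

(** Jensen's inequality for the concave function [min l]: integrate [min l N <= l] and
    [min l N <= N] separately. *)
Lemma expectation_truncated_count_le :
  (\int[P]_x (Num.min l%:R (N x))%:E <= (Num.min l%:R D)%:E)%E.
Proof.
rewrite EFin_min le_min -integral_N; apply/andP; split.
  rewrite -[leRHS]mule1 -(@probability_setT _ _ _ P) -integral_cst//.
  apply: ge0_le_integral => //.
  - by move=> x _; rewrite lee_fin min_ge0.
  - exact/measurable_EFinP.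
  - by move=> x _; rewrite lee_fin ge_min lexx.
apply: ge0_le_integral => //.
- by move=> x _; rewrite lee_fin min_ge0.
- exact/measurable_EFinP.
- exact/measurable_EFinP.
- by move=> x _; rewrite lee_fin ge_min lexx orbT.
Qed.

(* Second moment method: [min l N >= th * N - (th * N)^2 / (4 * l)] for
   [0 <= th <= 1], integrated with the choice [th = min l D / (C * D)]. *)
Lemma expectation_truncated_count_ge :
  ((Num.min l%:R D / (2 * C))%:E <= \int[P]_x (Num.min l%:R (N x))%:E)%E.
Proof.
set m := Num.min _ D.
have C_gt0 : 0 < C by exact: lt_le_trans C_ge1.
(* The choice of [th] divides by [D]; for [D = 0] the left side is 0. *)
have [D0|D_neq0] := eqVneq D 0.
  rewrite /m D0 min_r// mul0r; apply: integral_ge0 => x _.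
  by rewrite lee_fin min_ge0.
have D_gt0 : 0 < D by rewrite lt_def D_neq0.
have l0 : 0 < l%:R :> R by rewrite ltr0n.
have l1 : 1 <= l%:R :> R by rewrite ler1n.
have m0 : 0 < m by rewrite /m lt_min l0.
have ml : m <= l%:R by rewrite /m ge_min lexx.
have mD : m <= D by rewrite /m ge_min lexx orbT.
pose th := m / (C * D); pose q := th ^+ 2 / (4 * l%:R).
have th0 : 0 <= th by rewrite divr_ge0 ?mulr_ge0// ltW.
have th1 : th <= 1.
  rewrite ler_pdivrMr ?mulr_gt0// mul1r (le_trans mD)//.
  by rewrite ler_peMl.
have q0 : 0 <= q by rewrite divr_ge0 ?exprn_ge0// mulr_ge0.
have pointwise x : th * N x <= Num.min l%:R (N x) + q * N x ^+ 2.
  have : 0 <= q * N x ^+ 2 by rewrite mulr_ge0// exprn_ge0.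
  have thN : th * N x <= N x by rewrite ler_piMl.
  (* This square settles the case [l <= N x]; the case [N x < l] follows from [th <= 1]. *)
  have : 0 <= (th * N x - 2 * l%:R) ^+ 2 / (4 * l%:R).
    by rewrite divr_ge0 ?sqr_ge0// mulr_ge0.
  have -> : (th * N x - 2 * l%:R) ^+ 2 / (4 * l%:R)
      = q * N x ^+ 2 - th * N x + l%:R.
    by rewrite /q; field; rewrite lt0r_neq0.
  by case: (leP l%:R (N x)); lra.
have : ((th * D)%:E <= \int[P]_x (Num.min l%:R (N x))%:E
                       + (q * (D + C * D ^+ 2))%:E)%E.
  apply: (@le_trans _ _ (\int[P]_x (Num.min l%:R (N x) + q * N x ^+ 2)%:E)%E).
    rewrite EFinM -integral_N -ge0_integralZl_EFin//; last 2 first.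
    - by move=> x _; rewrite lee_fin.
    - exact/measurable_EFinP.
    apply: ge0_le_integral => //.
    - by move=> x _; rewrite mule_ge0 ?lee_fin.
    - by apply/measurable_EFinP; exact: measurable_funM.
    - apply/measurable_EFinP; apply: measurable_funD => //.
      by apply: measurable_funM => //; exact: measurable_funX.
    - by move=> x _; rewrite -EFinM lee_fin.
  under eq_integral do rewrite EFinD EFinM.
  rewrite ge0_integralD//; last 4 first.
  - by move=> x _; rewrite lee_fin min_ge0.
  - exact/measurable_EFinP.
  - by move=> x _; rewrite mule_ge0 ?lee_fin ?exprn_ge0.
  - apply/measurable_EFinP.
    by apply: measurable_funM => //; exact: measurable_funX.
  rewrite ge0_integralZl_EFin//; last 2 first.
  - by move=> x _; rewrite lee_fin exprn_ge0.
  - by apply/measurable_EFinP; exact: measurable_funX.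
  by apply: leeD2l; rewrite [leRHS]EFinM; apply: lee_wpmul2l; rewrite ?lee_fin.
rewrite -leeBlDr//; apply: le_trans; rewrite -EFinB lee_fin.
have -> : th * D = m / C by rewrite /th; field; rewrite !lt0r_neq0.
(* Both terms of the last factor are at most 1, so the quadratic loss is at most [m / (2 * C)], half
   of the main term [m / C]. *)
have -> : q * (D + C * D ^+ 2)
    = m / (4 * C) * (m / D / l%:R / C + m / l%:R).
  by rewrite /q /th; field; rewrite !lt0r_neq0.
have mC : 0 < m / (4 * C) by rewrite divr_gt0 ?mulr_gt0.
have mDlC : m / D / l%:R / C <= 1.
  rewrite !ler_pdivrMr// mul1r (le_trans mD)// -[leLHS]mul1r ler_wpM2r//.
  by rewrite -[leLHS]mulr1 ler_pM.
have ml1 : m / l%:R <= 1 by rewrite ler_pdivrMr// mul1r.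
have : m / (4 * C) * (m / D / l%:R / C + m / l%:R) <= m / (4 * C) * 2.
  apply: ler_wpM2l; first exact: ltW.
  by lra.
have -> : m / (2 * C) = m / C - m / (4 * C) * 2.
  by field; rewrite lt0r_neq0.
by lra.
Qed.

End truncated_count.

(** * Superlevel sets: product measure, measurability, monotonicity *)

(** The set is the disjoint union of the slices [{i} x A i], and each singleton has counting measure
    1. *)
Lemma counting_prodE d (T : measurableType d) (R : realType)
    (mu : {sigma_finite_measure set T -> \bar R}) (n : nat)
    (A : 'I_n.+1 -> set T) :
  (forall i, measurable (A i)) ->
  ((counting \x mu) [set x | A x.1 x.2] = \sum_(i < n.+1) mu (A i))%E.
Proof.
move=> mA.
have -> : [set x : 'I_n.+1 * T | A x.1 x.2]
    = \bigcup_(i in [set: 'I_n.+1]) ([set i] `*` A i).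
  apply/seteqP; split => [[i x] /= Aix|[i x] [j _ [/= -> //]]].
  by exists i.
have mX i : measurable ([set i] `*` A i) by exact: measurableX.
rewrite measure_fin_bigcup//; last 2 first.
- exact: finite_finset.
- by move=> i j _ _ [[k x] /= [[<- _] [-> _]]].
have -> : [set: 'I_n.+1] = [set` enum 'I_n.+1].
  by apply/seteqP; split => i //= _; rewrite mem_enum.
rewrite -fsbig_seq ?enum_uniq//= big_enum/=; apply: eq_bigr => i _.
have counting1 : counting [set i] = 1%E :> \bar R.
  by rewrite /counting asboolT// fset_set1 finmap.cardfs1.
by rewrite [LHS]product_measure1E//= counting1 mul1e.
Qed.

Lemma measurable_natr_bool d (T : measurableType d) (R : realType)
    (b : T -> bool) :
  measurable_fun setT b -> measurable_fun setT (fun x => (b x)%:R : R).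
Proof.
move=> mb; have -> : (fun x => (b x)%:R) = (fun x => if b x then 1 else 0 : R).
  by apply/funext => x; case: (b x).
exact: measurable_fun_ifT.
Qed.

Lemma measurable_bool_set d (T : measurableType d) (b : T -> bool) :
  measurable_fun setT b -> measurable [set x | b x].
Proof.
move=> mb; rewrite -[X in measurable X]setTI.
exact: (mb measurableT [set true]).
Qed.

Lemma measurable_superlevel d (T : measurableType d) (R : realType)
    (f : T -> R) (s : R) :
  measurable_fun setT f -> measurable [set x | s < `|f x|].
Proof.
move=> mf; apply/measurable_bool_set/measurable_fun_ltr => //.
exact: measurableT_comp.
Qed.

Lemma superlevel_nonincreasing d (T : measurableType d) (R : realType)
    (m : {measure set T -> \bar R}) (f : T -> R) (D : R -> R) :
  measurable_fun setT f ->
  (forall s : R, m [set x | s < `|f x|] = (D s)%:E) -> nonincreasing_fun D.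
Proof.
move=> mf mD s t st; rewrite -lee_fin -!mD le_measure ?inE//.
- exact: measurable_superlevel.
- exact: measurable_superlevel.
- by move=> x /=; exact: le_lt_trans.
Qed.

(** * Layer cake formulas for both sides *)

(** The rearrangement at [t] is the length of the set of [s >= 0] with [t < D s]. After exchanging
    the integrals, the [t] in [[0, l]] with [t < D s] have length [min l (D s)]. *)
Lemma integral_decreasing_rearrangement d (T : measurableType d) (R : realType)
    (m : {measure set T -> \bar R}) (f : T -> R) (D : R -> R) (l : R) :
  measurable_fun setT f ->
  (forall s : R, m [set x | s < `|f x|] = (D s)%:E) -> 0 <= l ->
  (\int[lebesgue_measure]_(t in `[0%R, l]) decreasing_rearrangement m f t
    = \int[lebesgue_measure]_(s in `[0%R, +oo[) (Num.min l (D s))%:E)%E.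
Proof.
move=> mf mD l0.
have D_ge0 s : 0 <= D s by rewrite -lee_fin -mD.
have D_noninc := superlevel_nonincreasing mf mD.
have mlt (t : R) : measurable (`[0, +oo[ `&` [set s | t < D s]).
  apply: measurableI => //; apply/measurable_bool_set/measurable_fun_ltr => //.
  exact: nonincreasing_measurable.
transitivity (\int[lebesgue_measure]_(t in `[0%R, l])
    \int[lebesgue_measure]_(s in `[0%R, +oo[) (t < D s)%R%:R%:E)%E.
  apply: eq_integral => t _.
  rewrite integral_bool//=; last exact: mlt.
  have -> : [set s | t < D s] = ~` [set s | D s <= t].
    by apply/seteqP; split => s /=; rewrite ltNge => /negP.
  rewrite lebesgue_measure_initial_segment; last first.
    by move=> x y /= Dx xy; apply: le_trans Dx; exact: D_noninc.
  rewrite /decreasing_rearrangement; congr (ereal_inf (_ @` _)).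
  by apply/seteqP; split => s [s0]; rewrite /= mD lee_fin.
transitivity (\int[lebesgue_measure]_(s in `[0%R, +oo[)
    \int[lebesgue_measure]_(t in `[0%R, l]) (t < D s)%R%:R%:E)%E.
  apply: (@tonelli_in _ _ _ _ R lebesgue_measure lebesgue_measure _ _
    (fun z => (z.1 < D z.2)%R%:R%:E)) => //.
  apply/measurable_EFinP/measurable_natr_bool; apply: measurable_fun_ltr => //.
  by apply: measurableT_comp => //; exact: nonincreasing_measurable.
by apply: eq_integral => s _; rewrite integral_lt_itv0l.
Qed.

(** Each nonnegative [kmax k y] is the integral over [s >= 0] of the indicator of [s < kmax k y];
    these indicators are then summed at fixed [s]. *)
Lemma sum_kmax_layer_cake (R : realType) (n l : nat) (y : 'I_n -> R) :
  (forall i, 0 <= y i) -> (l <= n)%N ->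
  ((\sum_(1 <= k < l.+1) kmax k y)%R%:E =
   \int[lebesgue_measure]_(s in `[0%R, +oo[)
     (Num.min l%:R (\sum_(i < n) (s < y i)%R%:R))%:E)%E.
Proof.
move=> y0 ln.
under eq_integral do rewrite -sum_lt_kmax// -sumEFin.
rewrite ge0_integral_sum//; last first.
  move=> k; apply/measurable_funTS/measurable_EFinP/measurable_natr_bool.
  exact: measurable_fun_ltr.
rewrite -sumEFin; apply: eq_bigr => k _.
by rewrite integral_lt_itv0y// kmax_ge0.
Qed.

(** * Comparison level by level and integration over the levels *)

Theorem theorem1p1 (R : realType) (d : measure_display)
    (Omega : measurableType d) (mu : probability Omega R) (n : nat)
    (G : set ('I_n.+1 -> Omega)) (G0 : G !=set0)
    (FG : set (set (subtype_of G0))) (FG_sigma : sigma_algebra setT FG)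
    (ev_meas : forall i : 'I_n.+1,
      measurable_fun setT (fun g : g_sigma_algebraType FG => sval g i))
    (CG : R) (CG_ge1 : 1 <= CG)
    (P : probability (g_sigma_algebraType FG) R)
    (marginal : forall (i : 'I_n.+1) (A : set Omega), measurable A ->
      P [set g | A (sval g i)] = mu A)
    (pairs : forall (i1 i2 : 'I_n.+1) (A1 A2 : set Omega), i1 != i2 ->
      measurable A1 -> measurable A2 ->
      (P [set g | A1 (sval g i1) /\ A2 (sval g i2)] <= CG%:E * mu A1 * mu A2)%E)
    (a : 'I_n.+1 * Omega -> R) (a_meas : measurable_fun setT a)
    (l : nat) (l_ge1 : (1 <= l)%N) (l_le : (l <= n.+1)%N) :
  let astar := decreasing_rearrangement (counting \x mu)%E a in
  let c : R := (48 * (1 + 2 * CG) ^+ 2)^-1 in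
  let C : R := 6 * (1 + 2 * CG) in
  (c%:E * \int[lebesgue_measure]_(t in `[0%R, l%:R%R]) astar t
     <= \int[P]_g
          (\sum_(1 <= k < l.+1) kmax k (fun i => `|a (i, sval g i)|))%R%:E)%E
  /\
  (\int[P]_g
      (\sum_(1 <= k < l.+1) kmax k (fun i => `|a (i, sval g i)|))%R%:E
     <= C%:E * \int[lebesgue_measure]_(t in `[0%R, l%:R%R]) astar t)%E.
Proof.
have CG_gt0 : 0 < CG by exact: lt_le_trans CG_ge1.
pose A i (s : R) := [set w | s < `|a (i, w)|].
have ma i : measurable_fun setT (fun w => a (i, w)).
  exact: measurable_fun_pair2.
have mA i s : measurable (A i s).
  exact: measurable_superlevel.
(* [mu] is a probability and the index set is finite, so the distribution function of [a] is
   real-valued and [fine] loses nothing. *)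
pose p s i := fine (mu (A i s)); pose D s := \sum_(i < n.+1) p s i.
have muA i s : mu (A i s) = (p s i)%:E by rewrite fineK// fin_num_measure.
have sigmaE (s : R) : ((counting \x mu) [set x | s < `|a x|]%R = (D s)%:E)%E.
  transitivity ((counting \x mu) [set x | A x.1 s x.2])%E.
    by congr ((counting \x mu) _)%E; apply/seteqP; split => -[].
  rewrite (counting_prodE mu (fun i => mA i s)) -sumEFin.
  by apply: eq_bigr => i _; exact: muA.
move=> astar c C; rewrite {}/astar.
rewrite (@integral_decreasing_rearrangement _ _ _ (counting \x mu)%E a D)//.
pose E s i := [set g : g_sigma_algebraType FG | A i s (sval g i)].
have mE s i : measurable (E s i).
  by rewrite -[X in measurable X]setTI; exact: ev_meas.
have PE s i : P (E s i) = (p s i)%:E by rewrite -muA -(marginal i _ (mA i s)).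
have PEI s i j : i != j -> (P (E s i `&` E s j) <= (CG * p s i * p s j)%:E)%E.
  by move=> ij; rewrite !EFinM -!muA; exact: pairs.
pose N s (g : g_sigma_algebraType FG) : R := \sum_(i < n.+1) \1_(E s i) g.
have NE s g : N s g = \sum_(i < n.+1) (s < `|a (i, sval g i)|)%R%:R.
  by apply: eq_bigr => i _; rewrite indicE [_ \in _]asboolb.
(* Tonelli requires measurability jointly in the level and in [g]. *)
have mN : measurable_fun setT (fun z : R * g_sigma_algebraType FG =>
    Num.min l%:R (N z.1 z.2)).
  apply: measurable_minr => //.
  suff : measurable_fun setT (fun z : R * g_sigma_algebraType FG =>
      \sum_(i < n.+1) (z.1 < `|a (i, sval z.2 i)|)%R%:R : R).
    by apply: eq_measurable_fun => z _; rewrite NE.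
  apply: measurable_sum => i.
  apply/measurable_natr_bool/measurable_fun_ltr => //.
  apply: measurableT_comp => //; apply: (measurableT_comp (ma i)).
  exact: (measurableT_comp (ev_meas i) measurable_snd).
have N_ge0 s g : 0 <= N s g by apply: sumr_ge0 => i _.
have min_ge0 s g : (0 <= (Num.min l%:R (N s g))%:E)%E.
  by rewrite lee_fin le_min ler0n N_ge0.
have -> : (\int[P]_g (\sum_(1 <= k < l.+1)
      kmax k (fun i => `|a (i, sval g i)|))%R%:E
    = \int[lebesgue_measure]_(s in `[0%R, +oo[)
        \int[P]_g (Num.min l%:R (N s g))%:E)%E.
  transitivity (\int[P]_g \int[lebesgue_measure]_(s in `[0%R, +oo[)
      (Num.min l%:R (N s g))%:E)%E.
    apply: eq_integral => g _; rewrite sum_kmax_layer_cake//.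
    by apply: eq_integral => s _; rewrite NE.
  apply/esym/(@tonelli_in _ _ _ _ R lebesgue_measure P _ _
    (fun z => (Num.min l%:R (N z.1 z.2))%:E)) => //.
  exact/measurable_EFinP.
have mD : measurable_fun setT D.
  apply: nonincreasing_measurable => //.
  exact: superlevel_nonincreasing a_meas sigmaE.
have D_ge0 s : 0 <= D s by apply: sumr_ge0 => i _; rewrite -lee_fin -muA.
have mminD : measurable_fun setT (fun s => (Num.min l%:R (D s))%:E).
  by apply/measurable_EFinP; exact: measurable_minr.
have mEN : measurable_fun setT (fun s => \int[P]_g (Num.min l%:R (N s g))%:E)%E.
  apply: (@measurable_integral_in _ _ _ _ R P _
    (fun z => (Num.min l%:R (N z.1 z.2))%:E)) => //.
  exact/measurable_EFinP.
have minD_ge0 s : (0 <= (Num.min l%:R (D s))%:E)%E.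
  by rewrite lee_fin le_min ler0n D_ge0.
have c_ge0 : 0 <= c by rewrite invr_ge0 mulr_ge0// sqr_ge0.
split.
  rewrite -ge0_integralZl_EFin//; last exact: measurable_funTS.
  apply: ge0_le_integral => //.
  - by move=> s _; rewrite mule_ge0.
  - by apply: measurable_funTS; exact: emeasurable_funM.
  - exact: measurable_funTS.
  - move=> s _.
    apply: le_trans (expectation_truncated_count_ge (mE s) (PE s) CG_ge1
      (@PEI s) l_ge1).
    rewrite -EFinM lee_fin mulrC ler_wpM2l// ?le_min ?ler0n ?D_ge0//.
    (* The second moment bound has constant [1 / (2 * CG)], and
       [2 * CG <= 48 * (1 + 2 * CG) ^+ 2]. *)
    rewrite lef_pV2 ?posrE ?mulr_gt0 ?exprn_gt0//; nra.
(* The upper bound is obtained with constant 1, then weakened using [1 <= C]. *)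
apply: (@le_trans _ _ (\int[lebesgue_measure]_(s in `[0%R, +oo[)
    (Num.min l%:R (D s))%:E)%E).
  apply: ge0_le_integral => //.
  - by move=> s _; exact: integral_ge0.
  - exact: measurable_funTS.
  - exact: measurable_funTS.
  - by move=> s _; exact: expectation_truncated_count_le.
rewrite -[leLHS]mul1e lee_wpmul2r ?integral_ge0// lee_fin.
by rewrite /C; lra.
Qed.
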